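(* Let $n\geqslant 3$, let $m$ be an integer with $0\leqslant m<n-1$, and let $a=(a_1,\dots,a_m)\in\mathbb{R}^m$ be such that the polynomial $P(t)=t^m+\sum_{r=1}^m(-1)^ra_rt^{m-r}$ has $m$ real roots $y_1,\dots,y_m$ (counted with multiplicity); put $y=(y_1,\dots,y_m)$ and $$F(\lambda)=\sigma_{n-1}^{(n)}(\lambda)+\sum_{r=1}^ma_r\sigma_{n-r-1}^{(n)}(\lambda).$$ Let $C>0$. Then there exist constants $\gamma\in(0,1)$ and $K_0>0$, depending only on $n$, $C$ and $(a_1,\dots,a_m)$, such that for every $\lambda=(\lambda_1,\dots,\lambda_n)\in\mathbb{R}^n$ with $(\lambda,y)\in\Gamma_{n-1}^{n+m}$, $\lambda_1\geqslant\lambda_2\geqslant\cdots\geqslant\lambda_n$, $C>F(\lambda)>1/C$ and $\lambda_1>K_0$, and for every $\xi=(\xi_1,\dots,\xi_n)\in\mathbb{R}^n$, $$-\sum_{p\neq q}\frac{F_{pq}\xi_p\xi_q}{F}+2\frac{\left(\sum_iF_i\xi_i\right)^2}{F^2}+2\sum_{i>1}\frac{F_i\xi_i^2}{(\lambda_1-\lambda_i+1)F}\geqslant(1+\gamma)\frac{F_1\xi_1^2}{\lambda_1F},$$ where $F$, $F_i$, $F_{pq}$ are evaluated at $\lambda$.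
   Context: $\sigma_j^{(N)}$ denotes the $j$-th elementary symmetric function on $\mathbb{R}^N$, with $\sigma_0^{(N)}=1$ and $\sigma_j^{(N)}=0$ for $j<0$ or $j>N$. The G{\aa}rding cone is $\Gamma_j^{N}=\{\mu\in\mathbb{R}^{N}:\sigma_i^{(N)}(\mu)>0,\ i=1,\dots,j\}$. $(\lambda,y)\in\mathbb{R}^{n+m}$ is the concatenation of $\lambda$ and $y$. $F_i=\partial F/\partial\lambda_i$ and $F_{pq}=\partial^2F/\partial\lambda_p\partial\lambda_q$. The sum over $p\neq q$ runs over all ordered pairs of distinct indices in $\{1,\dots,n\}$. When $m=0$, $F=\sigma_{n-1}^{(n)}$ and $(\lambda,y)=\lambda$. *)

(* Defs.v *)
From HB Require Import structures.
From mathcomp Require Import all_boot all_order all_algebra.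
From mathcomp Require Import all_classical all_reals all_analysis.
From mathcomp Require Import -(notations) mpoly.

Set Implicit Arguments.
Unset Strict Implicit.
Unset Printing Implicit Defensive.

Import Order.TTheory GRing.Theory Num.Theory.
Import numFieldNormedType.Exports.

Local Open Scope ring_scope.

(* In degree j > N, [mesym] is an empty sum, hence 0. *)
Definition esym (R : comNzRingType) (N j : nat) (mu : 'rV[R]_N) : R :=
  meval (fun i => mu 0 i) (mesym N R j).

Lemma esymE (R : comNzRingType) (N j : nat) (mu : 'rV[R]_N) :
  esym j mu = \sum_(A : {set 'I_N} | #|A| == j) \prod_(i in A) mu 0 i.
Proof.
rewrite /esym /mesym rmorph_sum /=; apply: eq_bigr => A _.
by rewrite rmorph_prod /=; apply: eq_bigr => i _; rewrite mevalXU.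
Qed.

Definition Garding_cone (R : realType) (N j : nat) : set 'rV[R]_N :=
  [set mu | forall i : nat, (1 <= i <= j)%N -> 0 < esym i mu].
Arguments Garding_cone : clear implicits.

Definition partial (R : realType) (n : nat) (i : 'I_n) (f : 'rV[R]_n -> R)
    (x : 'rV[R]_n) : R :=
  'D_(delta_mx 0 i : 'rV[R]_n) f x.

(* The index r : 'I_m is zero-based: [a 0 r] is the coefficient a_{r+1}. *)
Definition Ppoly (R : realType) (m : nat) (a : 'rV[R]_m) : {poly R} :=
  'X^m + \sum_(r < m) ((-1) ^+ r.+1 * a 0 r) *: 'X^(m - r.+1).

(* The natural-number subtraction [n - r.+1 - 1] truncates to 0 as soon as
   r + 2 >= n; it is the true difference whenever m < n - 1. *)
Definition Fop (R : realType) (n m : nat) (a : 'rV[R]_m) (x : 'rV[R]_n) : R :=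
  esym (n - 1) x + \sum_(r < m) a 0 r * esym (n - r.+1 - 1) x.

(* Main.v *)
(* Write mu = (lambda, y), so that F = e_{n-1}(mu) = s (lambda_1 + h), where, with
   lambda_1 left out, s = e_{n-2} and h = e_{n-1} / e_{n-2}.  Put L = lambda_1 + 1.
   The last sum of the inequality is what the second derivative of F gains when
   lambda_i (i > 1) moves so that 1 / (L - lambda_i) is affine; along such a path
   F = F0 + F1 t + F2 t^2 + ... and the right-hand side is 2 (F1/F0)^2 - 2 F2/F0.

   The key point is that along this path 1 / (b - h) is concave, where b is the
   value of h when every lambda_i (i > 1) is replaced by L.  This is proved for
   all quotients q_k = e_k / e_{k-1} by induction on k, because k q_k is the sum of
   the parallel sums of mu_i and of the q_{k-1} with mu_i left out, and both sums
   and parallel sums preserve this property.  It also makes every q_k concave, so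
   that s, a product of n - 2 of them, satisfies 2 (n-2) s0 s2 <= (n-3) s1^2.

   These two facts leave an inequality in lambda_1, h and b alone.  It holds since
   b ~ L / (n-1) as L tends to infinity, while h <= 1 as soon as lambda_1 >= C
   (otherwise Newton's inequalities give s >= 1 and F > C), and since
   1 / (n-1) < 2 / n for n >= 3. *)

Require Import Defs.
From HB Require Import structures.
From mathcomp Require Import all_boot all_order all_algebra.
From mathcomp Require Import all_classical all_reals all_analysis.
From mathcomp Require Import complex ring lra zify.
From mathcomp Require mpoly.
Import Order.TTheory GRing.Theory Num.Theory.
Import numFieldNormedType.Exports.

Set Implicit Arguments.
Unset Strict Implicit.
Unset Printing Implicit Defensive.

Local Open Scope classical_set_scope.
Local Open Scope ring_scope.

(** * Newton's inequalities *)

Section RealRooted.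
Variable C : numClosedFieldType.
Implicit Types (p : {poly C}) (rs : seq C).

(** Allowing [c = 0] admits the zero polynomial, so the class is closed under derivation in every
    degree. *)
Definition real_rooted p :=
  exists c rs, [/\ c \is Num.real, all (fun r => r \is Num.real) rs
    & p =  c *: \prod_(r <- rs) ('X - r%:P)].

(** With f the product, f'/f is the sum of the 1/(z - r), whose imaginary parts all have the sign
    opposite to that of Im z. Multiplying by |f(z)|^2 avoids the quotient. *)
Lemma Im_logderiv_prod rs z : all (fun r => r \is Num.real) rs ->
  'Im z != 0 -> rs != [::] ->
  'Im z * 'Im ((\prod_(r <- rs) ('X - r%:P))^`().[z]
               * ((\prod_(r <- rs) ('X - r%:P)).[z])^*) < 0.
Proof.
move=> rsR z_nR; have nz r : r \is Num.real -> z - r != 0.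
  by move=> rR; apply: contraNneq z_nR => /subr0_eq ->; apply/eqP/Creal_ImP.
elim: rs rsR => [//|r rs IH] /= /andP[rR rsR] _; rewrite big_cons.
set h := \prod_(_ <- _) _ in IH *.
rewrite derivM derivB derivX derivC subr0 mul1r !hornerE.
have -> : (h.[z] + (z - r) * h^`().[z]) * ((z - r) * h.[z])^* =
   `|h.[z]| ^+ 2 * (z - r)^* + `|z - r| ^+ 2 * (h^`().[z] * h.[z]^*).
  by rewrite !normCK rmorphM /=; ring.
have ImMlE (a b : C) : a \is Num.real -> 'Im (a * b) = a * 'Im b.
  by move=> aR; rewrite ImM (Creal_ReP _ aR) (Creal_ImP _ aR) mulr0 addr0.
rewrite raddfD /= (ImMlE (_ ^+ 2)) ?rpredX ?normr_real // (ImMlE (`|z - r| ^+ 2)) ?rpredX ?normr_real // Im_conj raddfB /=.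
have hnz : h.[z] != 0.
  rewrite /h horner_prod; rewrite prodf_seq_neq0; apply/allP => s srs /=.
  by rewrite !hornerE; apply: nz; apply: (allP rsR).
have zI2 : 0 < 'Im z ^+ 2 by rewrite real_exprn_even_gt0 // Creal_Im.
have n1 : 0 < `|h.[z]| ^+ 2 by rewrite exprn_gt0 // normr_gt0.
have n2 : 0 < `|z - r| ^+ 2 by rewrite exprn_gt0 // normr_gt0 nz.
rewrite (Creal_ImP _ rR) subr0; set t := 'Im (_ * _) in IH *.
have -> : 'Im z * (`|h.[z]| ^+ 2 * - 'Im z + `|z - r| ^+ 2 * t) =
  `|z - r| ^+ 2 * ('Im z * t) - `|h.[z]| ^+ 2 * 'Im z ^+ 2 by ring.
rewrite subr_lt0.
apply: (@le_lt_trans _ _ 0); last by rewrite mulr_gt0.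
case: (eqVneq rs [::]) => [rs0|rs0].
  by rewrite /t /h rs0 big_nil derivC hornerC mul0r raddf0 !mulr0.
by rewrite pmulr_rle0 // ltW // IH.
Qed.

(** At a nonreal root z of f', the product of f'(z) and the conjugate of f(z) would vanish, against
    [Im_logderiv_prod]. *)
Lemma real_rooted_deriv p : real_rooted p -> real_rooted p^`().
Proof.
move=> [c [rs [cR rsR ->]]]; rewrite derivZ; set f := \prod_(_ <- _) _.
have [f'0|f'0] := eqVneq f^`() 0.
  by exists 0, [::]; rewrite f'0 scaler0 scale0r; split=> //; apply: real0.
have [ss Ess] := closed_field_poly_normal f^`().
have f'R : f^`() \is a polyOver Num.real.
  apply: polyOver_deriv; rewrite /f big_seq; apply: rpred_prod => r rrs.
  by rewrite polyOverXsubC; apply: (allP rsR).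
exists (c * lead_coef f^`()), ss; split; last by rewrite -scalerA -Ess.
  by rewrite rpredM // lead_coefE; apply: (polyOverP f'R).
apply/allP => z zss; apply/Creal_ImP/eqP; apply: contraT => zI.
have rs0 : rs != [::].
  by apply: contraNneq f'0 => rs0; rewrite /f rs0 big_nil derivC.
have := Im_logderiv_prod rsR zI rs0; rewrite -/f.
suff -> : f^`().[z] = 0 by rewrite mul0r raddf0 mulr0 ltxx.
rewrite Ess hornerZ horner_prod (big_rem z) //=.
by rewrite hornerXsubC subrr mul0r mulr0.
Qed.

Lemma real_rooted_derivn p k : real_rooted p -> real_rooted p^`(k).
Proof. by move=> pR; elim: k => // k IH; rewrite derivnS; apply: real_rooted_deriv. Qed.

Lemma real_rootedM p q : real_rooted p -> real_rooted q -> real_rooted (p * q).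
Proof.
move=> [c [rs [cR rsR ->]]] [d [ss [dR ssR ->]]]; exists (c * d), (rs ++ ss).
by rewrite rpredM // all_cat rsR ssR big_cat /= -scalerAl -scalerAr scalerA.
Qed.

Lemma real_rooted1 : real_rooted 1.
Proof. by exists 1, [::]; rewrite big_nil scale1r; split=> //; apply: real1. Qed.

Lemma real_rooted_lin a : a \is Num.real -> real_rooted (1 + a%:P * 'X).
Proof.
move=> aR; have [->|a0] := eqVneq a 0.
  by rewrite mul0r addr0; apply: real_rooted1.
exists a, [:: - a^-1]; rewrite /= rpredN rpredV aR big_seq1; split=> //=.
by rewrite polyCN opprK scalerDr -!mul_polyC -polyCM divff // addrC.
Qed.

(** Laguerre's inequality: for f = (X - r) h, f'^2 - f f'' equals h^2 + (x - r)^2 (h'^2 - h h'') at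
    x. *)
Lemma laguerre_prod rs (x : C) : all (fun r => r \is Num.real) rs -> x \is Num.real ->
  let f := \prod_(r <- rs) ('X - r%:P) in
  [/\ f.[x] \is Num.real, f^`().[x] \is Num.real
    & 0 <= f^`().[x] ^+ 2 - f.[x] * f^`()^`().[x]].
Proof.
move=> rsR xR /=; elim: rs rsR => [_|r rs IH /= /andP[rR /IH]].
  by rewrite big_nil !derivC !hornerE real1 real0 expr0n /= subrr.
rewrite big_cons; set h := \prod_(_ <- _) _ => -[hR h'R H].
have dX : (('X : {poly C}) - r%:P)^`() = 1 by rewrite derivB derivX derivC subr0.
rewrite derivM dX mul1r derivD derivM dX mul1r !hornerE; set a := h.[x]; set b := h^`().[x]; set d := h^`()^`().[x].
have lR : x - r \is Num.real by rewrite rpredB.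
split; [by rewrite rpredM | by rewrite rpredD // rpredM |].
rewrite /= (_ : _ - _ = a ^+ 2 + (x - r) ^+ 2 * (b ^+ 2 - a * d)); last by ring.
by apply: addr_ge0; [|apply: mulr_ge0 => //]; apply: real_exprn_even_ge0.
Qed.

End RealRooted.

Section Esp.
Variable I : finType.

Definition espoly (R : comNzRingType) (A : {set I}) (x : I -> R) : {poly R} :=
  \prod_(i in A) (1 + (x i)%:P * 'X).

(** Subsets of a fixed index type let a variable be left out as [A :\ i], without reindexing. *)
Definition esp (R : comNzRingType) k (A : {set I}) (x : I -> R) : R :=
  (espoly A x)`_k.

Section Ring.
Variable R : comNzRingType.
Implicit Types (A : {set I}) (x : I -> R).

Lemma esp0 A x : esp 0 A x = 1.
Proof.
rewrite /esp -horner_coef0 /espoly horner_prod big1 // => i _.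
by rewrite hornerD hornerM hornerX mulr0 addr0 hornerC.
Qed.

Lemma esp_set0 k x : esp k.+1 finset.set0 x = 0.
Proof. by rewrite /esp /espoly big_set0 coef1. Qed.

Lemma espD1 k A x i : i \in A ->
  esp k.+1 A x = esp k.+1 (A :\ i) x + x i * esp k (A :\ i) x.
Proof.
move=> iA; rewrite /esp /espoly (big_setD1 i iA) /=.
by rewrite mulrDl mul1r coefD -mulrA coefCM coefXM.
Qed.

Lemma setD1_ind (P : {set I} -> Prop) :
  P finset.set0 -> (forall A i, i \in A -> P (A :\ i) -> P A) -> forall A, P A.
Proof.
move=> P0 PS A; have [k] := ubnP #|A|; elim: k A => // k IH A.
have [->//|/finset.set0Pn[i iA]] := eqVneq A finset.set0.
by rewrite ltnS => Ak; apply: (PS A i iA); apply: IH; rewrite (cardsD1 i A) iA in Ak.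
Qed.

Lemma eq_esp k A x y : {in A, x =1 y} -> esp k A x = esp k A y.
Proof. by move=> xy; rewrite /esp /espoly; under eq_bigr => i iA do rewrite xy //. Qed.

(** Each e_{k+1} is affine in every variable, with slope e_k of the others. The derivation is
    abstract so that it can be formal differentiation when the variables are themselves
    polynomials. *)
Lemma esp_derivation (d : R -> R) k A x :
  {morph d : a b / a + b} -> (forall a b, d (a * b) = d a * b + a * d b) ->
  d (esp k.+1 A x) = \sum_(i in A) d (x i) * esp k (A :\ i) x.
Proof.
move=> dD dM.
have d0 : d 0 = 0 by apply: (@addrI _ (d 0)); rewrite -dD !addr0.
have d1 : d 1 = 0.
  by apply: (@addrI _ (d 1)); rewrite addr0 -{3}[1]mulr1 dM mulr1 mul1r.
elim/setD1_ind: A k => [|A i iA IH] k.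
  by rewrite esp_set0 big_set0.
rewrite (espD1 _ _ iA) dD dM IH (big_setD1 i iA) /= addrCA; congr (_ + _).
case: k => [|k].
  by rewrite esp0 d1 mulr0 addr0; apply: eq_bigr => j _; rewrite !esp0.
rewrite IH mulr_sumr -big_split /=; apply: eq_bigr => j.
rewrite finset.in_setD1 => /andP[ji jA].
have iAj : i \in A :\ j by rewrite finset.in_setD1 eq_sym ji.
have AE : A :\ j :\ i = A :\ i :\ j by rewrite !finset.setDDl finset.setUC.
by rewrite [in RHS](espD1 _ _ iAj) AE; ring.
Qed.

(** Euler's identity for a form of degree k + 1. *)
Lemma esp_euler k A x :
  \sum_(i in A) x i * esp k (A :\ i) x = k.+1%:R * esp k.+1 A x.
Proof.
elim/setD1_ind: A k => [|A i iA IH] k.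
  by rewrite esp_set0 big_set0 mulr0.
rewrite (big_setD1 i iA) /= (espD1 _ _ iA) mulrDr -IH.
case: k => [|k].
  by rewrite !esp0 addrC mul1r; congr (_ + _ * 1); apply: eq_bigr => j _; rewrite !esp0.
have -> : \sum_(j in A :\ i) x j * esp k.+1 (A :\ j) x =
   \sum_(j in A :\ i) x j * esp k.+1 (A :\ i :\ j) x
   + x i * \sum_(j in A :\ i) x j * esp k (A :\ i :\ j) x.
  rewrite mulr_sumr -big_split /=; apply: eq_bigr => j.
  rewrite finset.in_setD1 => /andP[ji jA].
  have iAj : i \in A :\ j by rewrite finset.in_setD1 eq_sym ji.
  have AE : A :\ j :\ i = A :\ i :\ j by rewrite !finset.setDDl finset.setUC.
  by rewrite (espD1 _ _ iAj) AE; ring.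
by rewrite !IH -[in RHS](natr1 k.+1); ring.
Qed.

Lemma esp1 A x : esp 1 A x = \sum_(i in A) x i.
Proof.
rewrite -[LHS]mul1r -(esp_euler 0 A x); apply: eq_bigr => i _.
by rewrite esp0 mulr1.
Qed.

End Ring.

Lemma esp_rmorph (R S : comNzRingType) (f : {rmorphism R -> S}) k A x :
  f (esp k A x) = esp k A (f \o x).
Proof.
rewrite /esp -coef_map /= /espoly rmorph_prod /=; congr (polyseq _)`_k; apply: eq_bigr => i _.
by rewrite rmorphD rmorphM /= rmorph1 map_polyC map_polyX.
Qed.

(** The k-th derivative of the generating polynomial is real-rooted; at 0 it and its next two
    derivatives are k! e_k, (k+1)! e_{k+1} and (k+2)! e_{k+2}. Laguerre's inequality there, divided
    by k!^2 (k+1), is the claim. *)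
Lemma esp_newtonC (C : numClosedFieldType) k A (x : I -> C) :
  (forall i, x i \is Num.real) ->
  k.+2%:R * (esp k A x * esp k.+2 A x) <= k.+1%:R * esp k.+1 A x ^+ 2.
Proof.
move=> xR.
have pR : real_rooted (espoly A x).
  rewrite /espoly; elim/big_ind: _ => [|p q|i _]; first exact: real_rooted1.
    exact: real_rootedM.
  exact: real_rooted_lin.
have [c [rs [cR rsR E]]] := real_rooted_derivn k pR.
have [_ _] := laguerre_prod rsR (real0 C).
set f := \prod_(_ <- _) _ in E * => L.
have c2 j : c * f^`(j).[0] = (k + j)`!%:R * esp (k + j) A x.
  rewrite -hornerZ -derivnZ -E /derivn -iterD -/(derivn _ _) horner_coef0.
  by rewrite coef_derivn addn0 addnC ffactnn mulr_natl.
have := c2 0%N; have := c2 1%N; have := c2 2%N.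
rewrite addn0 addn1 addn2 derivn0 derivn1 derivnS derivn1 => e2 e1 e0.
have : 0 <= c ^+ 2 * (f^`().[0] ^+ 2 - f.[0] * f^`()^`().[0]).
  by rewrite mulr_ge0 // real_exprn_even_ge0.
rewrite (_ : _ * _ = (c * f^`().[0]) ^+ 2 - (c * f.[0]) * (c * f^`()^`().[0]));
  last by ring.
rewrite e0 e1 e2 subr_ge0.
rewrite !factS !natrM; set t : C := (k`!)%:R.
have t0 : 0 < t by rewrite ltr0n fact_gt0.
have k0 : 0 < k.+1%:R :> C by rewrite ltr0n.
rewrite (_ : _ * _ = (t ^+ 2 * k.+1%:R) * (k.+2%:R * (esp k A x * esp k.+2 A x)));
  last by ring.
rewrite (_ : (_ * _) ^+ 2 = (t ^+ 2 * k.+1%:R) * (k.+1%:R * esp k.+1 A x ^+ 2));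
  last by ring.
by rewrite ler_pM2l // mulr_gt0 // exprn_gt0.
Qed.

Lemma esp_newton (R : rcfType) k A (x : I -> R) :
  esp k A x * esp k.+2 A x <= esp k.+1 A x ^+ 2.
Proof.
pose f : {rmorphism R -> complex R} := real_complex R.
have xR i : (f \o x) i \is Num.real by apply/complex_realP; exists (x i).
have := esp_newtonC k A xR; rewrite -!(esp_rmorph f).
rewrite -!(rmorph_nat f) -!(rmorphM, rmorphXn) lecR => H.
(* The factor (k+2)/(k+1) may be lowered to 1 only when the product is positive; otherwise the
   square dominates at once. *)
have [|Hpos] := lerP (esp k A x * esp k.+2 A x) 0.
  by move/le_trans; apply; apply: sqr_ge0.
rewrite -(ler_pM2l (_ : 0 < k.+1%:R)) ?ltr0n //; apply: le_trans H.
by rewrite ler_pM2r // ler_nat.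
Qed.

(** By Newton the ratios e_{j+1} / e_j decrease, so if the last exceeds 1 then all do, and e_k >=
    e_0 = 1. *)
Lemma esp_ge1 (R : rcfType) k (A : {set I}) (x : I -> R) :
  (forall j, (j <= k)%N -> 0 < esp j A x) ->
  esp k A x < esp k.+1 A x -> 1 <= esp k A x.
Proof.
elim: k => [|k IH] xA; first by rewrite esp0.
move=> e12; have e0 := xA k (leqnSn k).
suff e01 : esp k A x < esp k.+1 A x.
  by apply: le_trans (ltW e01); apply: IH => // j jk; apply/xA/leqW.
rewrite -(ltr_pM2r (xA k.+1 (leqnn _))) -expr2.
by apply: lt_le_trans (esp_newton k A x); rewrite ltr_pM2l.
Qed.

(** Leaving out a variable costs one order of positivity. With a, b, c consecutive functions of the
    remaining variables, a > 0 >= b, b + x_i a > 0 and c + x_i b > 0 would give a c > b^2, against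
    Newton. *)
Lemma esp_gt0_setD1 (R : rcfType) k (A : {set I}) (x : I -> R) (i : I) : i \in A ->
  (forall j, (j <= k.+1)%N -> 0 < esp j A x) ->
  forall j, (j <= k)%N -> 0 < esp j (A :\ i) x.
Proof.
move=> iA xA; elim=> [|j IH] jk; first by rewrite esp0.
have {}IH := IH (ltnW jk).
have := xA j.+1 (leqW jk); have := xA j.+2 jk; rewrite !(espD1 _ _ iA) => p2 p1.
have := esp_newton j (A :\ i) x.
set a := esp j _ _ in IH p1 *; set b := esp j.+1 _ _ in p1 p2 *.
set c := esp j.+2 _ _ in p2 *; case: (ltrP 0 b) => // b0 N.
have xi : 0 < x i.
  rewrite -(pmulr_lgt0 _ IH); apply: lt_le_trans p1 _.
  by rewrite gerDr.
have h1 : 0 < a * (c + x i * b) by rewrite mulr_gt0.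
have h2 : 0 <= - b * (b + x i * a) by rewrite mulr_ge0 ?oppr_ge0 // ltW.
by nra.
Qed.
End Esp.

(** * Second-order jets *)

Local Ltac nneg :=
  repeat first [assumption | exact: sqr_ge0 | exact: ler0n | by apply: ltW
               | apply: addr_ge0 | apply: mulr_ge0].

Lemma coef1M (R : nzRingType) (p q : {poly R}) :
  (p * q)`_1 = p`_0 * q`_1 + p`_1 * q`_0.
Proof. by rewrite coefM !big_ord_recr big_ord0 /= add0r. Qed.

Lemma coef2M (R : nzRingType) (p q : {poly R}) :
  (p * q)`_2 = p`_0 * q`_2 + p`_1 * q`_1 + p`_2 * q`_0.
Proof. by rewrite coefM !big_ord_recr big_ord0 /= add0r. Qed.

Section Jets.
Variable R : realFieldType.
Implicit Types (p q f : {poly R}) (U V : R).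

(** Polynomials stand for second-order expansions in the path parameter, so identities are taken
    modulo X^3. *)
Definition eqjet2 p q := forall j, (j < 3)%N -> p`_j = q`_j.

Lemma eqjet2P p q : p`_0 = q`_0 -> p`_1 = q`_1 -> p`_2 = q`_2 -> eqjet2 p q.
Proof. by move=> e0 e1 e2 [|[|[|j]]]. Qed.

Lemma eqjet2M p p' q q' : eqjet2 p p' -> eqjet2 q q' -> eqjet2 (p * q) (p' * q').
Proof.
move=> pp' qq' j j3; rewrite !coefM; apply: eq_bigr => i _.
rewrite pp' ?qq' //; last by rewrite (leq_ltn_trans _ j3) // -ltnS.
by rewrite (leq_ltn_trans _ j3) // leq_subr.
Qed.

Lemma eqjet2D p p' q q' : eqjet2 p p' -> eqjet2 q q' -> eqjet2 (p + q) (p' + q').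
Proof. by move=> pp' qq' j j3; rewrite !coefD pp' ?qq'. Qed.

Lemma eqjet2_sum (I : finType) (A : {set I}) (p q : I -> {poly R}) :
  (forall i, i \in A -> eqjet2 (p i) (q i)) ->
  eqjet2 (\sum_(i in A) p i) (\sum_(i in A) q i).
Proof. by move=> pq j j3; rewrite !coef_sum; apply: eq_bigr => i /pq/(_ j j3). Qed.

(* To second order at 0 the function 1 / (U - p) is concave; clearing the
   denominator keeps the condition meaningful when p(0) = U. *)
Definition rconcave U p :=
  [/\ p`_0 <= U, p`_2 <= 0 & p`_1 ^+ 2 <= (U - p`_0) * - p`_2].

Lemma rconcave0 : rconcave 0 0.
Proof. by split; rewrite !coef0 ?expr0n //= subrr mul0r. Qed.

(** The condition says that the matrix with rows (U - p_0, p_1) and (p_1, -p_2) is positive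
    semidefinite, which is stable under sums. *)
Lemma rconcaveD U V p q : rconcave U p -> rconcave V q -> rconcave (U + V) (p + q).
Proof.
move=> [pU p2 p1] [qV q2 q1]; split; rewrite !coefD; [exact: lerD | by lra |].
set X := U - p`_0 in p1; set Y := V - q`_0 in q1.
have X0 : 0 <= X by rewrite subr_ge0.
have Y0 : 0 <= Y by rewrite subr_ge0.
rewrite (_ : U + V - _ = X + Y); last by rewrite /X /Y; ring.
move: {pU qV} X0 Y0 p1 q1; move: X Y (p`_1) (q`_1) => X Y a b X0 Y0.
set E := - p`_2; set T := - q`_2 => aE bT.
have E0 : 0 <= E by rewrite oppr_ge0.
have T0 : 0 <= T by rewrite oppr_ge0.
rewrite opprD -/E -/T.
suff : 2 * a * b <= X * T + Y * E by move=> H; nra.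
have XT0 := mulr_ge0 X0 T0; have YE0 := mulr_ge0 Y0 E0.
have XYET : (a * b) ^+ 2 <= (X * T) * (Y * E).
  rewrite exprMn (_ : X * T * _ = (X * E) * (Y * T)); last by ring.
  by rewrite ler_pM ?sqr_ge0.
rewrite (le_trans (ler_norm _)) // -(ler_pXn2r (ltn0Sn 1)) ?nnegrE ?addr_ge0 //.
rewrite real_normK ?num_real //.
by have := sqr_ge0 (X * T - Y * E); nra.
Qed.

Lemma rconcave_sum (I : finType) (A : {set I}) (U : I -> R) (p : I -> {poly R}) :
  (forall i, i \in A -> rconcave (U i) (p i)) ->
  rconcave (\sum_(i in A) U i) (\sum_(i in A) p i).
Proof.
move=> Up; elim/big_ind2: _ => //; [exact: rconcave0 |].
by move=> V1 q1 V2 q2; apply: rconcaveD.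
Qed.

Lemma rconcaveZ c U p : 0 <= c -> rconcave U p -> rconcave (c * U) (c *: p).
Proof.
move=> c0 [pU p2 p1]; split; rewrite !coefZ; first exact: ler_wpM2l.
  by rewrite mulr_ge0_le0.
rewrite -mulrBr -mulrN mulrACA -expr2 exprMn.
by apply: ler_wpM2l => //; apply: sqr_ge0.
Qed.

(** This is the last condition of [rconcave] for a parallel sum, denominators cleared: x, q are the
    values, X, Y the gaps to the ceilings, a, b the first coefficients and -E, -T the second
    ones. *)
Lemma parallel_sum_ineq (x q X Y E T a b : R) :
  0 < x + q -> 0 <= X -> 0 <= Y -> 0 <= E -> 0 <= T ->
  a ^+ 2 <= X * E -> b ^+ 2 <= Y * T ->
  (x + q + X + Y) * (q ^+ 2 * a + x ^+ 2 * b) ^+ 2 <=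
  (x ^+ 2 * Y + q ^+ 2 * X + X * Y * (x + q)) *
  ((q * a - x * b) ^+ 2 + (x + q) * (x ^+ 2 * T + q ^+ 2 * E)).
Proof.
move=> v0 X0 Y0 E0 T0 aE bT.
pose z := q * a - x * b; pose w := Y * a - X * b.
pose S := X * Y * z ^+ 2 + 2 * x * q * z * w
  + x ^+ 2 * q ^+ 2 * (Y * E + X * T - 2 * a * b).
have S0 : 0 <= S.
  have x2q2 : 0 <= x ^+ 2 * q ^+ 2 by rewrite mulr_ge0 ?sqr_ge0.
  (* A zero gap forces a zero first coefficient; otherwise X Y S is a square plus nonnegative
     terms. *)
  have [X00|Xn0] := eqVneq X 0.
    have a0 : a = 0.
      by apply/eqP; rewrite -sqrf_eq0 eq_le sqr_ge0 andbT; move: aE; rewrite X00 mul0r.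
    rewrite /S /w X00 a0 !(mul0r, mulr0, subr0, oppr0, add0r, addr0).
    by apply: mulr_ge0 => //; apply: mulr_ge0.
  have [Y00|Yn0] := eqVneq Y 0.
    have b0 : b = 0.
      by apply/eqP; rewrite -sqrf_eq0 eq_le sqr_ge0 andbT; move: bT; rewrite Y00 mul0r.
    rewrite /S /w Y00 b0 !(mul0r, mulr0, subr0, oppr0, add0r, addr0).
    by apply: mulr_ge0 => //; apply: mulr_ge0.
  have Xp : 0 < X by rewrite lt_def Xn0.
  have Yp : 0 < Y by rewrite lt_def Yn0.
  rewrite -(pmulr_rge0 _ (mulr_gt0 Xp Yp)).
  rewrite (_ : _ * S = (X * Y * z + x * q * w) ^+ 2 + x ^+ 2 * q ^+ 2 *
    (Y ^+ 2 * (X * E - a ^+ 2) + X ^+ 2 * (Y * T - b ^+ 2))); last first.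
    by rewrite /S /z /w; ring.
  rewrite addr_ge0 ?sqr_ge0 // mulr_ge0 // addr_ge0 // mulr_ge0 ?sqr_ge0 //.
    by rewrite subr_ge0.
  by rewrite subr_ge0.
rewrite -subr_ge0 (_ : _ - _ = (x + q) * S
  + ((x + q) * x ^+ 4 + (x + q) ^+ 2 * (x ^+ 2 * X)) * (Y * T - b ^+ 2)
  + ((x + q) * q ^+ 4 + (x + q) ^+ 2 * (q ^+ 2 * Y)) * (X * E - a ^+ 2)); last first.
  by rewrite /S /z /w; ring.
have v00 := ltW v0.
have x4 : 0 <= x ^+ 4 by rewrite exprn_even_ge0.
have q4 : 0 <= q ^+ 4 by rewrite exprn_even_ge0.
rewrite -subr_ge0 in aE; rewrite -subr_ge0 in bT.
by nneg.
Qed.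

Lemma rconcave_parallel U V p q : rconcave U p -> rconcave V q ->
  0 < p`_0 + q`_0 -> 0 < U + V ->
  exists f, eqjet2 (f * (p + q)) (p * q) /\ rconcave (U * V / (U + V)) f.
Proof.
move=> [pU p2 p1] [qV q2 q1]; set x := p`_0 in pU p1 *; set y := q`_0 in qV q1 *.
move=> v0 W0.
have := @parallel_sum_ineq x y (U - x) (V - y) (- p`_2) (- q`_2) (p`_1) (q`_1) v0.
rewrite !subr_ge0 !oppr_ge0 => /(_ pU qV p2 q2 p1 q1).
set a := p`_1 in p1 *; set b := q`_1 in q1 *.
have vn : x + y != 0 by rewrite gt_eqF.
have Wn : U + V != 0 by rewrite gt_eqF.
(* Here [f0], [f1], [f2] expand p q / (p + q); -Z is the numerator of [f2] and N that of the gap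
   between U V / (U + V) and [f0]. *)
pose Z := (y * a - x * b) ^+ 2 + (x + y) * (x ^+ 2 * - q`_2 + y ^+ 2 * - p`_2).
pose N := x ^+ 2 * (V - y) + y ^+ 2 * (U - x) + (U - x) * (V - y) * (x + y).
pose f0 := x * y / (x + y).
pose f1 := (y ^+ 2 * a + x ^+ 2 * b) / (x + y) ^+ 2.
pose f2 := - Z / (x + y) ^+ 3.
rewrite -/N -/Z => H; exists (Poly [:: f0; f1; f2]); split.
  apply: eqjet2P; rewrite ?coef0M ?coef1M ?coef2M !coefD !coef_Poly /= -/x -/y -/a -/b.
  - by rewrite /f0; field.
  - by rewrite /f1 /f0; field.
  - by rewrite /f2 /f1 /f0 /Z; field.
have Nf0 : U * V / (U + V) - f0 = N / ((x + y) * (U + V)).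
  by rewrite /f0 /N; field; apply/andP.
have N0 : 0 <= N.
  have v1 := ltW v0; have X0 : 0 <= U - x by rewrite subr_ge0.
  have Y0 : 0 <= V - y by rewrite subr_ge0.
  by rewrite /N; nneg.
have Z0 : 0 <= Z.
  have v1 := ltW v0; have E0 : 0 <= - p`_2 by rewrite oppr_ge0.
  have T0 : 0 <= - q`_2 by rewrite oppr_ge0.
  by rewrite /Z; nneg.
split; rewrite !coef_Poly /=.
- by rewrite -subr_ge0 Nf0 divr_ge0 // mulr_ge0 // ltW.
- by rewrite /f2 mulNr oppr_le0 divr_ge0 // exprn_ge0 // ltW.
rewrite Nf0 /f1 /f2 mulNr opprK expr_div_n -exprM mulf_div.
rewrite ler_pdivrMr ?exprn_gt0 // [leRHS]mulrAC ler_pdivlMr; last first.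
  by rewrite !mulr_gt0 // exprn_gt0.
rewrite (_ : x + y + (U - x) + (V - y) = U + V) in H; last by ring.
rewrite [leLHS](_ : _ = (x + y) ^+ 4 * ((U + V) * (y ^+ 2 * a + x ^+ 2 * b) ^+ 2)).
  by rewrite [leRHS]mulrC ler_pM2l // exprn_gt0.
by ring.
Qed.

End Jets.

(** * Quotients of elementary symmetric functions *)

Section JetCoefficients.
Variables (R : comNzRingType) (I : finType).
Implicit Types (A : {set I}) (x : I -> {poly R}).

Lemma coef0_esp k A x : (esp k A x)`_0 = esp k A (fun i => (x i)`_0).
Proof.
rewrite -horner_coef0 -[_.[0]]/(horner_eval 0 _) esp_rmorph.
by apply: eq_esp => i _; rewrite /= /horner_eval horner_coef0.
Qed.

Lemma coef1_esp k A x : (esp k.+1 A x)`_1 =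
  \sum_(i in A) (x i)`_1 * esp k (A :\ i) (fun i => (x i)`_0).
Proof.
have -> : (esp k.+1 A x)`_1 = (esp k.+1 A x)^`()`_0 by rewrite coef_deriv mulr1n.
rewrite (esp_derivation _ _ _ (@derivD R) (@derivM R)) coef_sum.
by apply: eq_bigr => i _; rewrite coef0M coef_deriv mulr1n coef0_esp.
Qed.

(** Doubling avoids a division by 2 and matches the sum over ordered pairs. *)
Lemma coef2_esp k A x : (esp k.+2 A x)`_2 *+ 2 =
  \sum_(i in A) \sum_(j in A :\ i)
     (x i)`_1 * (x j)`_1 * esp k (A :\ i :\ j) (fun i => (x i)`_0)
  + (\sum_(i in A) (x i)`_2 * esp k.+1 (A :\ i) (fun i => (x i)`_0)) *+ 2.
Proof.
have -> : (esp k.+2 A x)`_2 *+ 2 = (esp k.+2 A x)^`()`_1 by rewrite coef_deriv.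
rewrite (esp_derivation _ _ _ (@derivD R) (@derivM R)) coef_sum -sumrMnl -big_split /=.
apply: eq_bigr => i _; rewrite coef1M !coef_deriv mulr1n coef1_esp coef0_esp.
rewrite mulr_sumr mulrnAl; congr (_ + _); apply: eq_bigr => j _; exact: mulrA.
Qed.

End JetCoefficients.

Section Quotients.
Variables (R : rcfType) (I : finType).
Implicit Types (A : {set I}) (x : I -> {poly R}) (U : I -> R).

(** By Euler, (k+2) e_{k+2}/e_{k+1} is the sum of the x_i e_{k+1}(A \ i)/e_{k+1}(A), and each term
    is the parallel sum of x_i and e_{k+1}(A \ i)/e_k(A \ i). *)
Lemma rconcave_esp_quot k A x U :
  (forall i, i \in A -> rconcave (U i) (x i)) ->
  (forall j, (j <= k)%N -> 0 < esp j A (fun i => (x i)`_0)) ->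
  0 < esp k A U /\
  exists q, eqjet2 (esp k.+1 A x) (q * esp k A x)
         /\ rconcave (esp k.+1 A U / esp k A U) q.
Proof.
elim: k A => [|k IH] A xU xA.
  rewrite esp0 ltr01; split=> //; exists (esp 1 A x); split.
    by move=> j _; rewrite esp0 mulr1.
  by rewrite divr1 !esp1; apply: rconcave_sum.
have [ekU [q [Eq [qb _ _]]]] := IH A xU (fun j jk => xA j (leqW jk)).
(* The quotient is positive at 0 and lies below its ceiling, so the ceiling is positive too. *)
have ek1U : 0 < esp k.+1 A U.
  have := xA k.+1 (leqnn _); rewrite -coef0_esp Eq // coef0M coef0_esp.
  rewrite pmulr_lgt0 ?xA // => q0.
  by rewrite -(pmulr_lgt0 _ (_ : 0 < (esp k A U)^-1)) ?invr_gt0 // (lt_le_trans q0).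
split=> //.
have stepE i : i \in A -> exists f,
    eqjet2 (f * esp k.+1 A x) (x i * esp k.+1 (A :\ i) x) /\
    rconcave (U i * esp k.+1 (A :\ i) U / esp k.+1 A U) f.
  move=> iA.
  have xAi : forall j, (j <= k)%N -> 0 < esp j (A :\ i) (fun i => (x i)`_0).
    exact: esp_gt0_setD1.
  have xUi j : j \in A :\ i -> rconcave (U j) (x j).
    by rewrite finset.in_setD1 => /andP[_ /xU].
  have [eU [p [Ep pb]]] := IH _ xUi xAi.
  (* This sum is e_{k+1}(A) / e_k(A \ i), as is the next one with U in place of x. *)
  have v0 : 0 < (x i)`_0 + p`_0.
    have := xA k.+1 (leqnn _); rewrite -coef0_esp (espD1 _ _ iA) coefD Ep // !coef0M.
    by rewrite -mulrDl coef0_esp pmulr_lgt0 ?xAi // addrC.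
  have W0 : 0 < U i + esp k.+1 (A :\ i) U / esp k (A :\ i) U.
    rewrite -(pmulr_lgt0 _ eU) mulrDl mulfVK ?gt_eqF // addrC.
    by rewrite -(espD1 _ _ iA).
  have [f [Ef fb]] := rconcave_parallel (xU i iA) pb v0 W0.
  exists f; split.
    move=> j j3.
    have e1 : eqjet2 (f * esp k.+1 A x) (f * (p * esp k (A :\ i) x + x i * esp k (A :\ i) x)).
      by rewrite (espD1 _ _ iA); apply: eqjet2M => //; apply: eqjet2D.
    rewrite e1 //.
    rewrite (_ : f * _ = f * (x i + p) * esp k (A :\ i) x); last by ring.
    rewrite (eqjet2M (q' := esp k (A :\ i) x) Ef) // -mulrA.
    by apply: eqjet2M => // l l3; rewrite Ep.
  suff <- : U i * (esp k.+1 (A :\ i) U / esp k (A :\ i) U) /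
    (U i + esp k.+1 (A :\ i) U / esp k (A :\ i) U) =
    U i * esp k.+1 (A :\ i) U / esp k.+1 A U by [].
  rewrite (espD1 _ _ iA); field.
  have := ek1U; rewrite (espD1 _ _ iA) => h.
  by rewrite !gt_eqF // addrC mulrC; apply/andP.
have /fin_all_exists[f fP] : forall i, exists f, i \in A ->
    eqjet2 (f * esp k.+1 A x) (x i * esp k.+1 (A :\ i) x) /\
    rconcave (U i * esp k.+1 (A :\ i) U / esp k.+1 A U) f.
  move=> i; case: (boolP (i \in A)) => [/stepE[f fP]|_]; first by exists f.
  by exists 0.
have k0 : k.+2%:R != 0 :> R by rewrite pnatr_eq0.
exists (k.+2%:R^-1 *: \sum_(i in A) f i); split.
  move=> j j3; rewrite -scalerAl coefZ mulr_suml.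
  rewrite (eqjet2_sum (q := fun i => x i * esp k.+1 (A :\ i) x)) //.
    rewrite esp_euler -polyC_natr coefCM mulrA mulVf // mul1r //.
  by move=> i /fP[].
suff -> : esp k.+2 A U / esp k.+1 A U =
   k.+2%:R^-1 * \sum_(i in A) U i * esp k.+1 (A :\ i) U / esp k.+1 A U.
  apply: rconcaveZ; first by rewrite invr_ge0 ler0n.
  by apply: rconcave_sum => i /fP[].
by rewrite -mulr_suml esp_euler -!mulrA mulKf.
Qed.

(** The hypothesis on a is second-order concavity of a^(1/K); multiplying by a concave b > 0 gives
    that of (a b)^(1/(K+1)). *)
Lemma power_concave_step (K a0 a1 a2 b0 b1 b2 : R) :
  0 < K -> 0 < b0 -> b2 <= 0 ->
  2 * K * a0 * a2 <= (K - 1) * a1 ^+ 2 ->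
  2 * (K + 1) * (b0 * a0) * (b0 * a2 + b1 * a1 + b2 * a0)
    <= (K + 1 - 1) * (b0 * a1 + b1 * a0) ^+ 2.
Proof.
move=> kR q0 q2 IH; rewrite -subr_ge0 -(pmulr_rge0 _ kR).
set t := (X in K * X).
have -> : K * t = (a1 * b0 - K * a0 * b1) ^+ 2
  + b0 ^+ 2 * (K + 1) * ((K - 1) * a1 ^+ 2 - 2 * K * a0 * a2)
  + 2 * K * (K + 1) * b0 * a0 ^+ 2 * - b2 by rewrite /t; ring.
rewrite -oppr_ge0 in q2; rewrite -subr_ge0 in IH.
have K1 : 0 <= K + 1 by rewrite addr_ge0 // ltW.
have q00 := ltW q0; have K0 := ltW kR; have two : 0 <= 2 :> R by [].
by nneg.
Qed.

(** Concavity of e_k^(1/k) along the path: e_{k+1} is e_k times a quotient with nonpositive second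
    coefficient. *)
Lemma rconcave_esp_power k A x U :
  (forall i, i \in A -> rconcave (U i) (x i)) ->
  (forall j, (j <= k)%N -> 0 < esp j A (fun i => (x i)`_0)) ->
  2 * k%:R * (esp k A x)`_0 * (esp k A x)`_2 <= (k%:R - 1) * (esp k A x)`_1 ^+ 2.
Proof.
move=> xU; elim: k => [|k IH] xA.
  by rewrite esp0 !coef1 /= !mulr0 expr0n mulr0.
have {}IH := IH (fun j jk => xA j (leqW jk)).
have [_ [q [Eq [_ q2 _]]]] := rconcave_esp_quot xU (fun j jk => xA j (leqW jk)).
have s0 : 0 < (esp k A x)`_0 by rewrite coef0_esp xA.
have := xA k.+1 (leqnn _); rewrite -coef0_esp !Eq // coef0M coef1M coef2M.
rewrite pmulr_lgt0 // => q0.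
have [k0|k0] := posnP k.
  by rewrite k0 esp0 !coef1 /=; nra.
have kR : 0 < k%:R :> R by rewrite ltr0n.
by rewrite -(natr1 k); apply: power_concave_step.
Qed.
End Quotients.

(** * F as an elementary symmetric polynomial *)

Section SymmetricForm.

Lemma esp_gt_card (R : comNzRingType) (I : finType) (A : {set I}) (x : I -> R) k :
  (#|A| < k)%N -> esp k A x = 0.
Proof.
elim/setD1_ind: A k => [|A i iA IH] [|k] //; first by rewrite esp_set0.
rewrite (cardsD1 i) iA /= add1n ltnS => Ak.
by rewrite (espD1 _ _ iA) !IH ?mulr0 ?addr0 // ltnW // ltnS.
Qed.

Lemma esym_esp (R : comNzRingType) N k (mu : 'rV[R]_N) :
  Defs.esym k mu = esp k [set: 'I_N]%SET (mu 0).
Proof.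
rewrite esymE /esp /espoly (eq_bigl xpredT) => [|i]; last by rewrite finset.in_setT.
under [in RHS]eq_bigr => i _ do rewrite addrC.
rewrite bigA_distr coef_sum [RHS](bigID (fun A : {set 'I_N} => #|A| == k)) /=.
rewrite [X in _ + X]big1 ?addr0 => [|A Ak].
  apply: eq_bigr => A /eqP Ak; rewrite -big_mkcond big_split /= prodr_const Ak.
  by rewrite -rmorph_prod coefCM coefXn eqxx mulr1.
rewrite -big_mkcond big_split /= prodr_const -rmorph_prod coefCM coefXn.
by rewrite eq_sym (negbTE Ak) mulr0.
Qed.

Lemma espoly_row_mx (R : comNzRingType) n m (x : 'rV[R]_n) (y : 'rV[R]_m) :
  espoly [set: 'I_(n + m)]%SET (row_mx x y 0) =
  espoly [set: 'I_n]%SET (x 0) * espoly [set: 'I_m]%SET (y 0).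
Proof.
have eT N (f : 'I_N -> R) : espoly [set: 'I_N]%SET f = \prod_i (1 + (f i)%:P * 'X).
  by apply: eq_bigl => i; rewrite finset.in_setT.
rewrite !eT big_split_ord /=; congr (_ * _); apply: eq_bigr => i _.
  by rewrite row_mxEl.
by rewrite row_mxEr.
Qed.

Variables (R : realType) (n m : nat) (a y : 'rV[R]_m).
Hypothesis ay : Ppoly a = \prod_(r < m) ('X - (y 0 r)%:P).

(** Vieta's formula; its sign cancels the one built into [Ppoly]. *)
Lemma Ppoly_coef (r : 'I_m) : a 0 r = esp r.+1 [set: 'I_m]%SET (y 0).
Proof.
rewrite -esym_esp.
have := @mpoly.mroots_coeff R m [tuple y 0 i | i < m] (lift ord0 r).
rewrite big_tuple /= /bump /= add1n.
have -> : \prod_(i < m) ('X - (tnth [tuple y 0 i0 | i0 < m] i)%:P) = Ppoly a.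
  by rewrite ay; apply: eq_bigr => i _; rewrite tnth_mktuple.
have -> : tnth [tuple y 0 i0 | i0 < m] = (fun i => y 0 i).
  by apply/funext => i; rewrite tnth_mktuple.
rewrite -/(Defs.esym r.+1 y) /Ppoly coefD coefXn coef_sum (bigD1 r) //=.
rewrite coefZ coefXn eqxx mulr1 big1 => [|s sr].
  have -> : (m - r.+1 == m)%N = false.
    by apply/negbTE; have := ltn_ord r; lia.
  rewrite add0r addr0 => /mulrI; apply.
  by rewrite unitrX // unitrN1.
rewrite coefZ coefXn (_ : (_ == _)%N = false) ?mulr0 //.
apply: contraNF sr => /eqP E; apply/eqP/val_inj => /=.
have := ltn_ord r; have := ltn_ord s; lia.
Qed.

(** The generating polynomial of (x, y) is a product, and F is the Cauchy product giving its
    coefficient n - 1. *)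
Lemma Fop_esp (x : 'rV[R]_n) : (m < n - 1)%N ->
  Fop a x = esp (n - 1) [set: 'I_(n + m)]%SET (row_mx x y 0).
Proof.
move=> mn; rewrite /esp espoly_row_mx mulrC coefM big_ord_recl subn0 /Fop !esym_esp.
congr (_ + _); first by rewrite -/(esp 0 _ _) esp0 mul1r.
pose G i := esp i.+1 [set: 'I_m]%SET (y 0) * esp (n - 1 - i.+1) [set: 'I_n]%SET (x 0).
transitivity (\sum_(r < m) G r).
  by apply: eq_bigr => r _; rewrite Ppoly_coef esym_esp /G subnAC.
(* The terms added beyond m vanish, as y has only m entries. *)
rewrite (big_ord_widen (n - 1) G (ltnW mn)) big_mkcond; apply: eq_bigr => i _ /=.
case: ifP => // /negbT; rewrite -leqNgt => mi.
rewrite -/(esp (bump 0 i) [set: 'I_m]%SET (y 0)) esp_gt_card ?mul0r //.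
by rewrite finset.cardsT card_ord.
Qed.

(** The function is affine in the variable, so its difference quotient is constant. A general A
    allows iteration to second derivatives. *)
Lemma partial_esp (A : {set 'I_(n + m)}) k (i : 'I_n) : lshift m i \in A ->
  partial i (fun x : 'rV[R]_n => esp k.+1 A (row_mx x y 0)) =
  (fun x => esp k (A :\ lshift m i)%SET (row_mx x y 0)).
Proof.
move=> iA; apply/funext => x; rewrite /partial /derive.
apply: (@cvg_lim _ (@norm_hausdorff _ R)); apply: cvg_near_cst.
near=> h; have h0 : h != 0 by near: h; exact: nbhs_dnbhs_neq.
rewrite /= !(espD1 _ _ iA).
have E j : esp j (A :\ lshift m i)%SET (row_mx (h *: delta_mx 0 i + x) y 0)
         = esp j (A :\ lshift m i)%SET (row_mx x y 0).
  apply: eq_esp => l; rewrite finset.in_setD1 => /andP[li _].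
  case: (split_ordP l) li => [l' ->|l' ->]; rewrite ?row_mxEl ?row_mxEr //.
  by rewrite (inj_eq (@lshift_inj _ _)) !mxE eqxx => /negbTE->; rewrite mulr0 add0r.
rewrite !E !row_mxEl !mxE !eqxx mulr1.
set c := esp k.+1 _ _; set d := esp k _ _.
rewrite (_ : _ - _ = h * d); last by ring.
by rewrite -[LHS]/(h^-1 * (h * d)) mulKf.
Unshelve. all: by end_near.
Qed.
End SymmetricForm.

(** * Final estimate and constants *)

Section Estimates.
Variable R : realFieldType.

(** Here d = n - 2, c = 1 + gamma, l = lambda_1, and s_j, h_j, F_j are the coefficients of s, h and
    F = s (lambda_1 + h) along the path. *)
Lemma final_ineq (d s0 s1 s2 h0 h1 h2 l b c xi F0 F1 F2 : R) :
  0 < d -> 0 < s0 -> 0 < l -> 0 < l + h0 -> h0 <= b -> h2 <= 0 -> 0 <= c ->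
  h1 ^+ 2 <= (b - h0) * - h2 ->
  2 * d * s0 * s2 <= (d - 1) * s1 ^+ 2 ->
  c * (2 * (d + 1) * (l + h0) + (d + 2) * (b - h0)) <= 2 * (d + 2) * l ->
  F0 = s0 * (l + h0) ->
  F1 = s0 * (xi + h1) + s1 * (l + h0) ->
  F2 = s0 * h2 + s1 * (xi + h1) + s2 * (l + h0) ->
  c * (s0 * xi ^+ 2 / (l * F0)) <= 2 * (F1 ^+ 2 / F0 ^+ 2) - 2 * (F2 / F0).
Proof.
move=> d0 s00 l0; set u := l + h0; set M := b - h0 => u0 hb h20 c0 h1M s2d cl.
have M0 : 0 <= M by rewrite subr_ge0.
set T := - h2 in h1M; have T0 : 0 <= T by rewrite oppr_ge0.
set p := xi + h1 => F0E F1E F2E.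
pose X := (d + 2) * p ^+ 2 + 2 * (d + 1) * u * T.
pose Y := 2 * (d + 1) * u + (d + 2) * M.
have d1 : 0 < d + 1 by rewrite addr_gt0.
have d2 : 0 < d + 2 by rewrite addr_gt0.
have X0 : 0 <= X.
  by rewrite /X; nneg.
(* Weighted Cauchy-Schwarz for xi = p - h1 with h1^2 <= M T, in a form without division since M may
   be 0. *)
have XY : 2 * (d + 1) * (d + 2) * u * xi ^+ 2 <= X * Y.
  pose P := (d + 2) ^+ 2 * (M * p ^+ 2); pose Q := 4 * (d + 1) ^+ 2 * u ^+ 2 * T.
  have P0 : 0 <= P by rewrite /P; nneg.
  have Q0 : 0 <= Q by rewrite /Q; nneg.
  pose t := 4 * (d + 1) * (d + 2) * u * (p * h1).
  have tPQ : t ^+ 2 <= 4 * P * Q.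
    rewrite -subr_ge0 (_ : _ - _ = 16 * ((d + 1) * (d + 2) * u * p) ^+ 2 * (M * T - h1 ^+ 2)).
      by rewrite -subr_ge0 in h1M; nneg.
    by rewrite /t /P /Q; ring.
  have tPQ' : - t <= P + Q.
    rewrite lerNl -subr_ge0 opprK addrC; apply: contraTT tPQ => //; rewrite -!ltNge => H.
    have := sqr_ge0 (P - Q); nra.
  rewrite -subr_ge0 (_ : _ - _ = (P + Q + t) + 2 * (d + 1) * (d + 2) * u * (M * T - h1 ^+ 2)).
    rewrite addr_ge0 //; first by rewrite -(opprK t) subr_ge0.
    by rewrite -subr_ge0 in h1M; nneg.
  by rewrite /X /Y /P /Q /t /p; ring.
pose G := 2 * F1 ^+ 2 - 2 * F2 * F0.
(* Completing the square in s1 eliminates s1 and s2. *)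
have GX : s0 ^+ 2 * X <= (d + 1) * G.
  rewrite -subr_ge0 -(pmulr_rge0 _ d0).
  rewrite (_ : d * _ = ((d + 1) * (s1 * u) + d * (s0 * p)) ^+ 2
     + (d + 1) * u ^+ 2 * ((d - 1) * s1 ^+ 2 - 2 * d * s0 * s2)).
    by rewrite -subr_ge0 in s2d; nneg.
  by rewrite /G F0E F1E F2E /X /T; ring.
have F00 : 0 < F0 by rewrite F0E mulr_gt0.
have -> : 2 * (F1 ^+ 2 / F0 ^+ 2) - 2 * (F2 / F0) = G / F0 ^+ 2.
  by rewrite /G; field; rewrite gt_eqF.
suff H : c * (s0 * xi ^+ 2) * F0 <= G * l.
  rewrite mulrA ler_pdivrMr ?mulr_gt0 // [leRHS]mulrAC ler_pdivlMr ?exprn_gt0 //.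
  have -> : c * (s0 * xi ^+ 2) * F0 ^+ 2 = c * (s0 * xi ^+ 2) * F0 * F0 by ring.
  by rewrite [G * _]mulrA ler_pM2r.
have dd : 0 < 2 * (d + 1) * (d + 2) by rewrite mulr_gt0 // mulr_gt0.
rewrite -(ler_pM2l dd).
have h1' : c * s0 ^+ 2 * (2 * (d + 1) * (d + 2) * u * xi ^+ 2) <= c * s0 ^+ 2 * (X * Y).
  by apply: ler_wpM2l => //; nneg.
have h2' : (s0 ^+ 2 * X) * (c * Y) <= (s0 ^+ 2 * X) * (2 * (d + 2) * l).
  by apply: ler_wpM2l => //; nneg.
have h3' : (2 * (d + 2) * l) * (s0 ^+ 2 * X) <= (2 * (d + 2) * l) * ((d + 1) * G).
  by apply: ler_wpM2l => //; nneg.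
apply: le_trans (_ : (2 * (d + 2) * l) * ((d + 1) * G) <= _); last by nra.
apply: le_trans h3'; rewrite [leRHS]mulrC; apply: le_trans h2'.
rewrite F0E; apply: le_trans (_ : c * s0 ^+ 2 * (X * Y) <= _); last by nra.
by apply: le_trans h1'; nra.
Qed.

(** Horner's scheme: enlarging K absorbs one lower coefficient at a time. The bound c_0 / 2, rather
    than mere positivity, makes the induction close. *)
Lemma poly_lead_pos (c : nat -> R) N : 0 < c 0 -> exists2 K, 0 < K &
  forall L, K <= L -> c 0 / 2 <= \sum_(r < N.+1) c r * L ^+ (N - r).
Proof.
move=> c0; elim: N => [|N [K K0 IH]].
  by exists 1 => // L _; rewrite big_ord1 subnn expr0 mulr1 ler_pdivrMr // ler_peMr ?ler1n // ltW.
exists (Num.max K (1 + 2 * `|c N.+1| / c 0)); first by rewrite lt_max K0.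
move=> L; rewrite ge_max => /andP[KL cL].
rewrite big_ord_recr /= subnn expr0 mulr1.
have -> : \sum_(i < N.+1) c i * L ^+ (N.+1 - i) = L * \sum_(i < N.+1) c i * L ^+ (N - i).
  rewrite mulr_sumr; apply: eq_bigr => i _.
  by rewrite subSn ?leq_ord // exprS mulrCA.
have := IH L KL; set S := \sum_(i < _) _ => HS.
have L0 : 0 < L by apply: lt_le_trans K0 KL.
have : L * (c 0 / 2) <= L * S by rewrite ler_pM2l.
have : (1 + 2 * `|c N.+1| / c 0) * (c 0 / 2) <= L * (c 0 / 2).
  by rewrite ler_pM2r // divr_gt0.
rewrite (_ : (1 + _) * _ = c 0 / 2 + `|c N.+1|); last by field; rewrite gt_eqF.
have := lerNnormlW (lexx `|c N.+1|).
by lra.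
Qed.
End Estimates.

Section Constants.

(** With N = n - 1, d is 2/n - 1/(n-1), the room left by b ~ L/(n-1). One quarter of it pays for the
    error in b and one for gamma. *)
Lemma constant_ineq (R : realFieldType) (N l h0 b : R) : 2 <= N ->
  let d := (N - 1) / ((N + 1) * N) in b <= (N^-1 + d / 4) * (l + 1) -> h0 <= 1 -> 12 * N ^+ 2 / (N - 1) <= l ->
  (1 + d / 4) * (2 * N * (l + h0) + (N + 1) * (b - h0)) <= 2 * (N + 1) * l.
Proof.
move=> N2 d bl h01 lN.
have N0 : 0 < N by lra.
have N1 : 0 < N - 1 by lra.
have N3 : 0 < N + 1 by lra.
have d0 : 0 < d by rewrite divr_gt0 // mulr_gt0.
have dE : (N + 1) * N * d = N - 1.
  by rewrite /d mulrC divfK // mulf_neq0 // gt_eqF.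
have iE : (N + 1) * N^-1 = 2 - (N + 1) * d.
  rewrite /d; field; apply/andP; split; rewrite gt_eqF //.
have {}lN : 12 * N <= (N + 1) * d * l.
  move: lN; rewrite ler_pdivrMr // => lN.
  rewrite -(ler_pM2l N0); apply: le_trans (_ : l * (N - 1) <= _); first by lra.
  by rewrite -dE; lra.
have d1 : (N + 1) * d <= 1.
  by rewrite -(ler_pM2l N0) mulr1; lra.
have l0 : 0 <= l.
  by rewrite -(pmulr_rge0 _ (mulr_gt0 N3 d0)); apply: le_trans lN; lra.
have bl' : (N + 1) * b <= (2 - (N + 1) * d * (3 / 4)) * (l + 1).
  apply: le_trans (_ : (N + 1) * ((N^-1 + d / 4) * (l + 1)) <= _).
    by rewrite ler_pM2l.
  rewrite (_ : (N + 1) * _ = ((N + 1) * N^-1 + (N + 1) * (d / 4)) * (l + 1)); last by ring.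
  by rewrite iE; lra.
have h0' : (N - 1) * h0 <= N - 1 by rewrite ger_pMr.
(* Of the remaining 3d/4, a quarter of d absorbs the terms bounded in l, by the lower bound on l. *)
have S : 2 * N * (l + h0) + (N + 1) * (b - h0) <= (2 - d / 2) * ((N + 1) * l).
  by nra.
(* The product (1 + d/4)(2 - d/2) is 2 - d^2/8. *)
apply: le_trans (_ : (1 + d / 4) * ((2 - d / 2) * ((N + 1) * l)) <= _).
  by apply: ler_wpM2l S; lra.
rewrite mulrA -[2 * (N + 1) * l]mulrA; apply: ler_wpM2r; first by apply: mulr_ge0 => //; lra.
by have := sqr_ge0 d; rewrite expr2; lra.
Qed.

Variables (R : realType) (k m : nat) (a : 'rV[R]_m).

(** The functions e_r(y) are read off a alone, with value 0 for r > m, so that thresholds can be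
    fixed before y is given. *)
Definition esp_of_coefs (r : nat) : R :=
  if r is r'.+1 then (if insub r' is Some s then a 0 s else 0) else 1.

Lemma esp_of_coefsE (y : 'rV[R]_m) r : Ppoly a = \prod_(r < m) ('X - (y 0 r)%:P) ->
  esp r [set: 'I_m]%SET (y 0) = esp_of_coefs r.
Proof.
case: r => [|r] ay /=; first by rewrite esp0.
case: insubP => [s _ <-|]; first by rewrite -(Ppoly_coef ay).
by rewrite -leqNgt => mr; rewrite esp_gt_card // finset.cardsT card_ord.
Qed.

Lemma coef_expD1X (L : R) N j : ((1 + L%:P * 'X) ^+ N)`_j = L ^+ j *+ 'C(N, j).
Proof.
rewrite exprDn coef_sum; have [jN|Nj] := leqP j N.
  rewrite (bigD1 (Ordinal (jN : (j < N.+1)%N))) //= big1 => [|i ij].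
    by rewrite expr1n mul1r exprMn -rmorphXn coefMn coefCM coefXn eqxx mulr1 addr0.
  rewrite expr1n mul1r exprMn -rmorphXn coefMn coefCM coefXn.
  by rewrite (_ : (_ == _) = false) ?mulr0 ?mul0rn //; apply: contraNF ij => /eqP e; apply/eqP/val_inj.
rewrite bin_small // mulr0n big1 // => i _.
rewrite expr1n mul1r exprMn -rmorphXn coefMn coefCM coefXn.
by rewrite gtn_eqF ?mulr0 ?mul0rn //; apply: leq_ltn_trans (leq_ord i) Nj.
Qed.

Lemma esp_const (y : 'rV[R]_m) (L : R) N (i : 'I_N.+1) j :
  esp j ([set: 'I_(N.+1 + m)] :\ lshift m i)%SET (row_mx (const_mx L) y 0) =
  \sum_(r < j.+1) esp r [set: 'I_m]%SET (y 0) * (L ^+ (j - r) *+ 'C(N, j - r)).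
Proof.
set A := (_ :\ _)%SET.
have E : espoly A (row_mx (const_mx L) y 0) =
    espoly [set: 'I_m]%SET (y 0) * (1 + L%:P * 'X) ^+ N.
  (* Leaving out one entry amounts to cancelling this factor from the full product. *)
  have nz : 1 + L%:P * 'X != 0 :> {poly R}.
    apply/eqP => /(congr1 (fun p : {poly R} => p.[0])).
    by rewrite hornerD hornerM hornerX mulr0 addr0 hornerC horner0 => /eqP; rewrite oner_eq0.
  apply: (mulfI nz); rewrite mulrCA -exprS.
  have := espoly_row_mx (const_mx L : 'rV_N.+1) y.
  rewrite {1}/espoly (big_setD1 (lshift m i)) ?finset.in_setT //= row_mxEl mxE => ->.
  rewrite mulrC; congr (_ * _); rewrite /espoly.
  rewrite (eq_bigr (fun _ => 1 + L%:P * 'X)) => [|l _]; last by rewrite mxE.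
  by rewrite prodr_const finset.cardsT card_ord.
by rewrite /esp E coefM; apply: eq_bigr => r _; rewrite coef_expD1X.
Qed.

(** Both sides are polynomials in L of degree N; the leading coefficient of right minus left is eps
    N > 0. *)
Lemma esp_const_quot_bound (eps : R) : 0 < eps ->
  exists2 K, 0 < K & forall (y : 'rV[R]_m) L (i : 'I_k.+3)
    (e := fun j => esp j ([set: 'I_(k.+3 + m)] :\ lshift m i)%SET
                         (row_mx (const_mx L) y 0)),
    Ppoly a = \prod_(r < m) ('X - (y 0 r)%:P) -> K <= L ->
    e k.+2 <= (k.+2%:R^-1 + eps) * L * e k.+1.
Proof.
move=> e0; set N := k.+2.
pose b := esp_of_coefs.
(* Coefficient of L^(N - r) in right minus left. *)
pose c r := (N%:R^-1 + eps) * (b r * 'C(N, r.+1)%:R) - b r * 'C(N, r)%:R.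
have N0 : N%:R != 0 :> R by rewrite pnatr_eq0.
have c0 : 0 < c 0%N.
  rewrite /c /= !mul1r bin1 bin0 mulrDl mulVf // addrC addKr.
  by rewrite mulr_gt0 // ltr0n.
have [K K0 KP] := poly_lead_pos N c0.
exists K => // y L i e ay /KP {KP} H.
rewrite -subr_ge0; apply: le_trans (le_trans (ltW (divr_gt0 c0 _)) H) _ => //.
rewrite le_eqVlt; apply/orP; left; apply/eqP.
rewrite /e !esp_const.
transitivity (\sum_(r < N.+1) (N%:R^-1 + eps) * (b r * 'C(N, r.+1)%:R * L ^+ (N - r))
  - \sum_(r < N.+1) b r * 'C(N, r)%:R * L ^+ (N - r)).
  by rewrite -sumrB; apply: eq_bigr => r _; rewrite /c; ring.
congr (_ - _); last first.
  apply: eq_bigr => r _; rewrite esp_of_coefsE // bin_sub ?leq_ord //.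
  by rewrite -/b -[L ^+ _ *+ _]mulr_natl mulrA.
(* The term r = N drops since C(N, N + 1) = 0, which matches the shorter sum for e_{k+1}. *)
rewrite -mulr_sumr big_ord_recr /= bin_small // mulr0 mul0r addr0 -mulrA [L * _]mulr_sumr.
congr (_ * _); apply: eq_bigr => r _; rewrite esp_of_coefsE // -/b.
have rk := leq_ord r.
rewrite -(@bin_sub k.+2 r.+1) // subSS (subSn rk) exprS.
by rewrite -[L ^+ _ *+ _]mulr_natl; ring.
Qed.
End Constants.

(** * The eigenvalue path *)

Section Path.
Variables (R : realType) (n m : nat) (lambda xi : 'rV[R]_n) (y : 'rV[R]_m) (i1 : 'I_n).

(** For i other than [i1] this gives equality in [rconcave] with ceiling lambda_1 + 1; at [i1] the
    motion is linear. *)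
Definition path_curv (i : 'I_n) : R :=
  if i == i1 then 0 else xi 0 i ^+ 2 / (lambda 0 i1 - lambda 0 i + 1).

(* The eigenvalues move so that 1 / (lambda_1 + 1 - lambda_i) is affine to
   second order for i > 1, which absorbs the last sum of the inequality. *)
Definition eigen_path (j : 'I_(n + m)) : {poly R} :=
  match fintype.split j with
  | inl i => Poly [:: lambda 0 i; xi 0 i; - path_curv i]
  | inr r => (y 0 r)%:P
  end.

Lemma eigen_path_l i : eigen_path (lshift m i) = Poly [:: lambda 0 i; xi 0 i; - path_curv i].
Proof. by rewrite /eigen_path (unsplitK (inl i)). Qed.

Lemma eigen_path_r r : eigen_path (rshift n r) = (y 0 r)%:P.
Proof. by rewrite /eigen_path (unsplitK (inr r)). Qed.

Lemma eigen_path0 : (fun j => (eigen_path j)`_0) = row_mx lambda y 0.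
Proof.
apply/funext => j; case: (split_ordP j) => r ->.
  by rewrite eigen_path_l row_mxEl coef_Poly.
by rewrite eigen_path_r row_mxEr coefC.
Qed.

Lemma eigen_path_rconcave (j : 'I_(n + m)) :
  (forall i, lambda 0 i <= lambda 0 i1) -> j != lshift m i1 ->
  rconcave (row_mx (const_mx (lambda 0 i1 + 1)) y 0 j) (eigen_path j).
Proof.
move=> l1; case: (split_ordP j) => r -> rj; last first.
  by rewrite eigen_path_r row_mxEr; split; rewrite !coefC //= expr0n /= subrr mul0r.
rewrite eigen_path_l row_mxEl mxE.
have ri : r != i1 by apply: contraNneq rj => ->.
have L0 : 0 < lambda 0 i1 - lambda 0 r + 1 by rewrite ltr_wpDl ?subr_ge0.
split; rewrite !coef_Poly /= /path_curv ?(negbTE ri).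
- by rewrite -subr_ge0; apply: le_trans (ltW L0) _; rewrite addrAC.
- by rewrite oppr_le0 divr_ge0 ?sqr_ge0 // ltW.
- by rewrite opprK mulrC addrAC divfK // gt_eqF // addrAC.
Qed.

Lemma big_lshift (G : 'I_(n + m) -> R) : (forall r, G (rshift n r) = 0) ->
  \sum_(j in [set: 'I_(n + m)]%SET) G j = \sum_(i < n) G (lshift m i).
Proof.
move=> G0; rewrite (eq_bigl xpredT) => [|j]; last by rewrite finset.in_setT.
by rewrite big_split_ord /= [X in _ + X]big1 ?addr0.
Qed.

Lemma esp_path1 k (T := [set: 'I_(n + m)]%SET) :
  (esp k.+1 T eigen_path)`_1 =
  \sum_(i < n) esp k (T :\ lshift m i)%SET (row_mx lambda y 0) * xi 0 i.
Proof.
rewrite coef1_esp big_lshift => [|r]; last by rewrite eigen_path_r coefC mul0r.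
by apply: eq_bigr => i _; rewrite eigen_path_l coef_Poly eigen_path0 mulrC.
Qed.

Lemma esp_path2 k (T := [set: 'I_(n + m)]%SET) :
  (esp k.+2 T eigen_path)`_2 *+ 2 =
  \sum_(p < n) \sum_(q < n | p != q)
     esp k (T :\ lshift m q :\ lshift m p)%SET (row_mx lambda y 0) * xi 0 p * xi 0 q
  - (\sum_(i < n) esp k.+1 (T :\ lshift m i)%SET (row_mx lambda y 0) * path_curv i) *+ 2.
Proof.
rewrite coef2_esp !big_lshift => [|r|r]; last 2 first.
- by rewrite eigen_path_r coefC mul0r.
- by rewrite big1 // => j _; rewrite eigen_path_r coefC !mul0r.
rewrite eigen_path0; congr (_ + _); last first.
  rewrite -mulNrn -sumrN; congr (_ *+ 2); apply: eq_bigr => i _.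
  by rewrite eigen_path_l coef_Poly mulNr mulrC.
apply: eq_bigr => p _.
(* Extending the sum by 0 at the omitted index lets [big_lshift] apply. *)
transitivity (\sum_(j in T) if j == lshift m p then 0 else
  (eigen_path (lshift m p))`_1 * (eigen_path j)`_1 *
     esp k (T :\ lshift m p :\ j)%SET (row_mx lambda y 0)).
  rewrite big_mkcond [RHS]big_mkcond; apply: eq_bigr => j _ /=.
  by rewrite finset.in_setD1; case: eqP => //=; case: ifP.
rewrite big_lshift => [|r]; last by rewrite eigen_path_r coefC mulr0 mul0r if_same.
rewrite [RHS]big_mkcond; apply: eq_bigr => q _ /=.
rewrite (inj_eq (@lshift_inj _ _)) eq_sym; case: eqP => //= _.
by rewrite !eigen_path_l !coef_Poly /= mulrC mulrA !finset.setDDl finset.setUC.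
Qed.

End Path.

Theorem lemma6p1 (R : realType) (n m : nat) (hn : (3 <= n)%N)
    (hm : (m < n - 1)%N) (a : 'rV[R]_m) (C : R) (hC : 0 < C) :
  let i1 : 'I_n := Ordinal (ltnW (ltnW hn)) in
  let F : 'rV[R]_n -> R := Fop a in
  exists gamma K0 : R, [/\ 0 < gamma, gamma < 1, 0 < K0 &
    forall y : 'rV[R]_m, Ppoly a = \prod_(r < m) ('X - (y 0 r)%:P) ->
    forall lambda : 'rV[R]_n,
      row_mx lambda y \in Garding_cone R (n + m) (n - 1) ->
      (forall i j : 'I_n, (i <= j)%N -> lambda 0 j <= lambda 0 i) ->
      F lambda < C -> 1 / C < F lambda -> K0 < lambda 0 i1 ->
    forall xi : 'rV[R]_n,
      (1 + gamma) * (partial i1 F lambda * xi 0 i1 ^+ 2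
                       / (lambda 0 i1 * F lambda))
      <= - (\sum_(p < n) \sum_(q < n | p != q)
              partial p (partial q F) lambda * xi 0 p * xi 0 q / F lambda)
         + 2 * ((\sum_(i < n) partial i F lambda * xi 0 i) ^+ 2
                  / F lambda ^+ 2)
         + 2 * (\sum_(i < n | (0 < i)%N)
                  partial i F lambda * xi 0 i ^+ 2
                    / ((lambda 0 i1 - lambda 0 i + 1) * F lambda))].
Proof.
move=> i1 F.
have [k nE] : exists k, n = k.+3 by exists (n - 3)%N; lia.
subst n; rewrite subn1 /= in hm *.
pose N : R := k.+2%:R; pose d := (N - 1) / ((N + 1) * N).
have N2 : 2 <= N by rewrite ler_nat.
have N1 : 0 < N - 1 by lra.
have N0 : 0 < N by lra.
have N3 : 0 < N + 1 by lra.
have d0 : 0 < d by rewrite divr_gt0 // mulr_gt0.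
have d1 : d < 1.
  by rewrite ltr_pdivrMr ?mulr_gt0 // mul1r; nra.
have d40 : 0 < d / 4 by lra.
have [K K0 KP] := esp_const_quot_bound k a d40.
(* The three thresholds serve, in order, h <= 1, the bound on b, and the absorption of bounded
   terms. *)
exists (d / 4), (Num.max C (Num.max K (12 * N ^+ 2 / (N - 1)))).
split; [by [] | by lra | by rewrite lt_max hC | ].
move=> y ay lambda cone sorted FC _ lK xi.
move: lK; rewrite !gt_max => /andP[lC /andP[lK lN]].
set l := lambda 0 i1 in lC lK lN *.
have l0 : 0 < l by apply: lt_trans lC.
have l1 i : lambda 0 i <= lambda 0 i1 by apply: sorted.
pose T := [set: 'I_(k.+3 + m)]%SET; pose mu := row_mx lambda y 0.
pose j1 := lshift m i1; pose A := (T :\ j1)%SET.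
have FE : F = fun x => esp k.+2 T (row_mx x y 0).
  by apply/funext => x; rewrite /F (Fop_esp ay) // subn1.
have dF i : partial i F = fun x => esp k.+1 (T :\ lshift m i)%SET (row_mx x y 0).
  by rewrite FE partial_esp // finset.in_setT.
have ddF p q : p != q -> partial p (partial q F) =
    fun x => esp k (T :\ lshift m q :\ lshift m p)%SET (row_mx x y 0).
  move=> pq; rewrite dF partial_esp // finset.in_setD1 finset.in_setT andbT.
  by rewrite (inj_eq (@lshift_inj _ _)).
have muT j : (j <= k.+2)%N -> 0 < esp j T mu.
  case: j => [|j] jk; first by rewrite esp0.
  by rewrite -esym_esp; move: cone; rewrite inE; apply.
have j1T : j1 \in T by rewrite finset.in_setT.
have muA j : (j <= k.+1)%N -> 0 < esp j A mu by apply: (esp_gt0_setD1 j1T muT).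
pose x := eigen_path lambda xi y i1.
have x0 : (fun j => (x j)`_0) = mu by apply: eigen_path0.
pose U : 'I_(k.+3 + m) -> R := row_mx (const_mx (l + 1)) y 0.
have xU j : j \in A -> rconcave (U j) (x j).
  by rewrite finset.in_setD1 => /andP[jj1 _]; apply: eigen_path_rconcave.
have xA j : (j <= k.+1)%N -> 0 < esp j A (fun i => (x i)`_0) by rewrite x0; apply: muA.
(* Here q is the jet of h = e_{n-1} / e_{n-2} with lambda_1 left out. *)
have [eU [q [Eq [qb q2 q1]]]] := rconcave_esp_quot xU xA.
have pw := rconcave_esp_power xU xA.
set b := esp k.+2 A U / esp k.+1 A U in qb q1.
have bl : b <= (N^-1 + d / 4) * (l + 1).
  rewrite ler_pdivrMr //; apply: (KP y (l + 1) i1 ay).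
  by rewrite ltW // (lt_trans lK) // ltrDl.
set s := esp k.+1 A x in Eq pw.
have s0E : s`_0 = esp k.+1 A mu by rewrite /s coef0_esp x0.
have s0 : 0 < s`_0 by rewrite s0E muA.
have FT : esp k.+2 T x = esp k.+2 A x + x j1 * s by rewrite (espD1 _ _ j1T).
have xj1 : x j1 = Poly [:: l; xi 0 i1; 0].
  by rewrite /x eigen_path_l /path_curv eqxx oppr0.
have F0E : F lambda = (esp k.+2 T x)`_0 by rewrite FE coef0_esp x0.
have F0 : F lambda = s`_0 * (l + q`_0).
  by rewrite F0E FT coefD Eq // !coef0M xj1 coef_Poly /=; ring.
have F1 : (esp k.+2 T x)`_1 = s`_0 * (xi 0 i1 + q`_1) + s`_1 * (l + q`_0).
  by rewrite FT coefD Eq // !coef1M xj1 !coef_Poly /=; ring.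
have F2 : (esp k.+2 T x)`_2 = s`_0 * q`_2 + s`_1 * (xi 0 i1 + q`_1) + s`_2 * (l + q`_0).
  by rewrite FT coefD Eq // !coef2M xj1 !coef_Poly /=; ring.
have F0pos : 0 < F lambda by rewrite FE; apply: muT.
have u0 : 0 < l + q`_0 by move: F0pos; rewrite F0 pmulr_rgt0.
(* If h > 1 then s >= 1 by [esp_ge1], so F = s (l + h) >= l > C. *)
have q01 : q`_0 <= 1.
  rewrite leNgt; apply/negP => q1'.
  have e12 : esp k.+1 A mu < esp k.+2 A mu.
    have -> : esp k.+2 A mu = q`_0 * s`_0 by rewrite -x0 -coef0_esp Eq // coef0M.
    by rewrite -s0E ltr_pMl.
  have := esp_ge1 muA e12; rewrite -s0E => s1.
  move: FC; rewrite F0 ltNge => /negP; apply.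
  apply: le_trans (ltW lC) _; apply: le_trans (_ : 1 * (l + q`_0) <= _).
    by rewrite mul1r lerDl; lra.
  by rewrite ler_pM2r.
have cl := constant_ineq N2 bl q01 (ltW lN).
have d41 : 0 <= 1 + d / 4 by lra.
have Nk : N = k.+1%:R + 1 by rewrite natr1.
have := @final_ineq R k.+1%:R _ _ _ _ _ _ _ _ _ (xi 0 i1) _ _ _ _ s0 l0 u0 qb q2 d41 q1 pw _ F0 F1 F2.
rewrite ltr0Sn => /(_ isT).
rewrite (_ : k.+1%:R + 2 = N + 1); last by rewrite Nk; ring.
rewrite -Nk => /(_ cl); rewrite s0E -[esp k.+1 A mu](congr1 (fun f => f lambda) (dF i1)).
(* The two right-hand sides agree: 2 F2 splits into the sum over p, q and the curvature sum, which
   becomes the last sum of the statement. *)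
move=> H; apply: le_trans H _; rewrite le_eqVlt; apply/orP; left; apply/eqP.
have -> : (esp k.+2 T x)`_1 = \sum_(i < k.+3) partial i F lambda * xi 0 i.
  by rewrite esp_path1; apply: eq_bigr => i _; rewrite dF.
have -> : 2 * ((esp k.+2 T x)`_2 / F lambda) = (esp k.+2 T x)`_2 *+ 2 / F lambda.
  by rewrite mulrA mulr_natl.
have subr_rot (u v w : R) : u - (v - w) = - v + (u + w) by ring.
rewrite esp_path2 mulrBl subr_rot -[RHS]addrA; congr (_ + _).
  congr (- _); rewrite mulr_suml; apply: eq_bigr => p _.
  by rewrite mulr_suml; apply: eq_bigr => q' pq; rewrite ddF.
congr (_ + _); rewrite -mulr_natl -mulrA; congr (_ * _).
rewrite mulr_suml [RHS]big_mkcond; apply: eq_bigr => i _ /=.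
rewrite /path_curv -val_eqE /= lt0n; case: eqP => [_|_] /=; first by rewrite mulr0 mul0r.
by rewrite dF invfM !mulrA.
Qed.
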